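(* Let $n\ge1$. The number of elements in the set $PD2N_n$ of normalized Dumont permutations of the second kind in $S_{2n+2}$ is equal to the number of elements in the set $DC_n$ of Dellac configurations.
   Context: $PD2N_n$ is the set of permutations $\sigma\in S_{2n+2}$ such that: $\sigma(k)<k$ if $k$ is even; $\sigma(k)>k$ if $k$ is odd ($1\le k\le 2n+2$); and $\sigma^{-1}(2k)<\sigma^{-1}(2k+1)$ for $k=1,\dots,n$. Dellac configurations: consider a rectangle with $n$ columns and $2n$ rows, whose boxes are labeled by pairs $(l,j)$, where $l=1,\dots,n$ is the number of the column and $j=1,\dots,2n$ is the number of the row. A Dellac configuration $D$ is a subset of boxes such that: each column contains exactly two boxes from $D$; each row contains exactly one box from $D$; and if $(l,j)\in D$, then $l\le j\le n+l$. $DC_n$ is the set of all such $D$. *)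

(* Defs.v *)
From mathcomp Require Import all_boot all_fingroup.

Set Implicit Arguments.
Unset Strict Implicit.
Unset Printing Implicit Defensive.

(* Positions, values, rows and columns are numbered from 1, ordinals from 0:
   i : 'I_m stands for the number i + 1. *)
Definition label (m : nat) (i : 'I_m) : nat := i.+1.

Definition dumont2 (n : nat) (s : 'S_((2 * n).+2)) : bool :=
  [forall k : 'I_((2 * n).+2),
    if odd (label k) then label k < label (s k) else label (s k) < label k].

Definition normalized (n : nat) (s : 'S_((2 * n).+2)) : bool :=
  [forall k : 'I_n, forall x : 'I_((2 * n).+2), forall y : 'I_((2 * n).+2),
    (label x == 2 * label k) && (label y == 2 * label k + 1) ==>
      (label ((s^-1)%g x) < label ((s^-1)%g y))].

Definition PD2N (n : nat) : {set 'S_((2 * n).+2)} :=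
  [set s : 'S_((2 * n).+2) | dumont2 s && normalized s].

(* A box is a pair (column, row). *)
Definition dellac (n : nat) (D : {set 'I_n * 'I_(2 * n)}) : bool :=
  [&& [forall l : 'I_n, #|[set b in D | b.1 == l]| == 2],
      [forall j : 'I_(2 * n), #|[set b in D | b.2 == j]| == 1]
    & [forall b in D, label b.1 <= label b.2 <= n + label b.1]].

Definition DC (n : nat) : {set {set 'I_n * 'I_(2 * n)}} :=
  [set D : {set 'I_n * 'I_(2 * n)} | dellac D].

(* Main.v *)
Require Import Defs.
From mathcomp Require Import all_boot all_fingroup.
From mathcomp Require Import zify.

Set Implicit Arguments.
Unset Strict Implicit.
Unset Printing Implicit Defensive.

(* Group the values of a permutation as 1 | 2 3 | 4 5 | ... | 2n+2, the k-th
   block being [uphalf] of the 0-based value.  Both Dumont inequalities only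
   depend on the block of [s p], and normalization says that [s] is the
   standardization of the word of blocks, so [s] is determined by that word.
   Position 2 (resp. 2n+1) necessarily carries the value 1 (resp. 2n+2).  The
   other positions are the rows of a Dellac configuration, the block being the
   column: the even positions 4, 6, ..., 2n+2 become the rows 1, ..., n and the
   odd positions 1, 3, ..., 2n-1 become the rows n+1, ..., 2n. *)

(** * Counting initial segments *)

Lemma card_ord_lt m r : r <= m -> #|[set v : 'I_m | v < r]| = r.
Proof.
move=> le_rm; rewrite -sum1_card.
rewrite (eq_bigl (fun v : 'I_m => v < r)); last by move=> v; rewrite inE.
by rewrite (big_ord_narrow le_rm) sum1_card card_ord.
Qed.

Lemma card_lt_eq (T : finType) (f g : T -> nat) c :
  (forall d, #|[set x | f x == d]| = #|[set x | g x == d]|) ->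
  #|[set x | f x < c]| = #|[set x | g x < c]|.
Proof.
move=> eq_fg.
have lt_rec (h : T -> nat) d :
    #|[set x | h x < d.+1]| = #|[set x | h x < d]| + #|[set x | h x == d]|.
  rewrite -cardsUI (_ : _ :&: _ = set0) ?cards0 ?addn0.
    by congr #|pred_of_set _|; apply/setP => x; rewrite !inE; lia.
  by apply/setP => x; rewrite !inE; lia.
elim: c => [|c IHc]; last by rewrite !lt_rec IHc eq_fg.
by congr #|pred_of_set _|; apply/setP => x; rewrite !inE.
Qed.

(** * Standardization of words *)

Section Standardization.

Variable m : nat.

(* Encodes the lexicographic order on the pairs (g p, p). *)
Definition lexkey (g : 'I_m -> nat) (p : 'I_m) : nat := g p * m + p.

(** The values of the standardization of the word [g]: equal letters are numbered from left to
    right. *)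
Definition lexrank (g : 'I_m -> nat) (p : 'I_m) : nat :=
  #|[set q | lexkey g q < lexkey g p]|.

Lemma lexkey_lt g p q :
  (lexkey g q < lexkey g p) = (g q < g p) || (g q == g p) && (q < p).
Proof.
rewrite /lexkey; have := ltn_ord p; have := ltn_ord q.
case: (ltngtP (g q) (g p)) => [lt_qp|lt_pq|->] /=; last by lia.
- have : (g q).+1 * m <= g p * m by rewrite leq_mul2r lt_qp orbT.
  by rewrite mulSn; lia.
- have : (g p).+1 * m <= g q * m by rewrite leq_mul2r lt_pq orbT.
  by rewrite mulSn; lia.
Qed.

Lemma lexrank_lt g p : lexrank g p < m.
Proof.
rewrite -[X in _ < X]card_ord -cardsT; apply: proper_card.
rewrite properT; apply/eqP => /setP/(_ p).
by rewrite !inE ltnn.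
Qed.

Lemma lexrank_mono g p q : lexkey g p < lexkey g q -> lexrank g p < lexrank g q.
Proof.
move=> lt_pq; apply: proper_card; apply/properP; split.
  by apply/subsetP => r; rewrite !inE => /ltn_trans; apply.
by exists p; rewrite !inE ?ltnn.
Qed.

Lemma lexrank_inj g : injective (fun p => Ordinal (lexrank_lt g p)).
Proof.
move=> p q [eq_pq]; apply: val_inj => /=.
have := @lexrank_mono g p q; have := @lexrank_mono g q p.
by rewrite !lexkey_lt eq_pq ltnn; lia.
Qed.

Variable h : 'I_m -> nat.
Hypothesis h_mono : forall u v : 'I_m, u <= v -> h u <= h v.

Definition standard (s : 'S_m) : Prop :=
  forall p q : 'I_m, h (s p) = h (s q) -> p < q -> s p < s q.

(** Keys and values are ordered alike: [h_mono] decides between different blocks, standardness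
    inside one block. Hence the positions with a smaller key are the preimages under [s] of the
    values below [s p]. *)
Lemma standard_lexrank s : standard s -> forall p, val (s p) = lexrank (h \o s) p.
Proof.
move=> std_s p; rewrite -[LHS](card_ord_lt (ltnW (ltn_ord (s p)))) /lexrank.
rewrite -(card_imset _ (@perm_inj _ (s^-1)%g)); congr #|pred_of_set _|.
apply/setP => q; rewrite -{1}(permK s q) mem_imset; last exact: perm_inj.
rewrite !inE lexkey_lt /=.
have [eq_pq|/eqP ne_pq] := eqVneq (h (s q)) (h (s p)).
  rewrite eq_pq ltnn /=; case: (ltngtP q p) => [lt_qp|lt_pq|/val_inj->].
  - exact: std_s.
  - by have := std_s _ _ (esym eq_pq) lt_pq; lia.
  - by rewrite ltnn.
rewrite orbF; case: (leqP (s p) (s q)) => [/h_mono|/ltnW/h_mono]; lia.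
Qed.

Lemma standard_unique s t :
  standard s -> standard t -> (forall p, h (s p) = h (t p)) -> s = t.
Proof.
move=> std_s std_t eq_st; apply/permP => p; apply: val_inj => /=.
rewrite [LHS]standard_lexrank // [RHS]standard_lexrank //.
rewrite /lexrank /lexkey /=; congr #|pred_of_set _|.
by apply/setP => q; rewrite !inE !eq_st.
Qed.

(** The permutation is [lexrank g]; equal letter counts force each of its values into the right
    block. *)
Lemma standard_exists g :
    (forall c, #|[set p | g p == c]| = #|[set v | h v == c]|) ->
  exists2 s : 'S_m, standard s & forall p, h (s p) = g p.
Proof.
move=> eq_gh; have [s sE] : exists s : 'S_m, forall p, val (s p) = lexrank g p.
  by exists (perm (@lexrank_inj g)) => p; rewrite permE.
have hs p : h (s p) = g p.
  case: (ltngtP (h (s p)) (g p)) => // lt_c; exfalso; last first.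
    (* Block too high: all values in blocks up to [g p] lie below [s p], but there are more of them
       than the rank of [p], since [p] itself is counted. *)
    have : #|[set v | h v < (g p).+1]| <= s p.
      rewrite -[X in _ <= X](card_ord_lt (ltnW (ltn_ord (s p)))).
      apply/subset_leq_card/subsetP => v; rewrite !inE => hv.
      by rewrite ltnNge; apply/negP => /h_mono; lia.
    rewrite -(card_lt_eq _ eq_gh) sE leqNgt => /negP[].
    apply: proper_card; apply/properP; split; last by exists p; rewrite !inE ?ltnn.
    by apply/subsetP => q; rewrite !inE lexkey_lt; lia.
  (* Block too low: the [s p + 1] values up to [s p] all lie in blocks below [g p], which hold at
     most [lexrank g p] values. *)
  have : s p < #|[set v | h v < g p]|.
    rewrite -[X in X <= _](card_ord_lt (ltn_ord (s p))).
    apply/subset_leq_card/subsetP => v; rewrite !inE ltnS => /h_mono; lia.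
  rewrite -(card_lt_eq _ eq_gh) sE ltnNge => /negP[].
  by apply/subset_leq_card/subsetP => q; rewrite !inE lexkey_lt => ->.
exists s => // p q; rewrite !hs => eq_pq lt_pq.
rewrite [val _]sE [X in _ < X]sE; apply: lexrank_mono.
by rewrite lexkey_lt eq_pq eqxx lt_pq orbT.
Qed.

End Standardization.

(** * Both conditions on permutations in terms of blocks *)

Section DumontDellac.

Variable n : nat.
Notation N := (2 * n).+2.

Definition block (v : 'I_N) : nat := uphalf v.

Lemma block_mono (u v : 'I_N) : u <= v -> block u <= block v.
Proof. exact: uphalf_leq. Qed.

(** Counted from 0, an odd number is the least of its block and an even one the greatest, so below
    an odd position, or above an even one, means in an earlier, or later, block. *)
Lemma dumont2P (s : 'S_N) :
  reflect (forall p : 'I_N, if odd p then block (s p) < block p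
                            else block p < block (s p)) (dumont2 s).
Proof.
apply: (iffP forallP) => Hs p; have := Hs p; rewrite /label /block /=;
  by case: (boolP (odd p)) => /=; lia.
Qed.

Lemma normalizedP (s : 'S_N) : reflect (standard block s) (normalized s).
Proof.
apply: (iffP idP) => [/forallP nrm p q eq_pq lt_pq | std_s].
  rewrite ltnNge; apply/negP => le_qp.
  have ne_pq : s p <> s q :> nat.
    by move=> /val_inj/perm_inj eq_p; rewrite eq_p ltnn in lt_pq.
  (* The smaller value [s q] of the block is odd, so the labels are [2k] and [2k + 1], where [k] has
     0-based index [(s q)./2]. *)
  have lt_n : (s q)./2 < n by have := ltn_ord (s p); rewrite /block in eq_pq; lia.
  have /forallP/(_ (s q))/forallP/(_ (s p)) := nrm (Ordinal lt_n).
  by rewrite !permK /label /=; rewrite /block in eq_pq; lia.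
apply/forallP => k; apply/forallP => x; apply/forallP => y.
apply/implyP; rewrite /label => /andP[/eqP xE /eqP yE].
rewrite ltnS ltnNge; apply/negP => le_yx.
have eq_xy : block (s (s^-1 y)%g) = block (s (s^-1 x)%g).
  by rewrite !permKV /block; lia.
have := std_s _ _ eq_xy; rewrite !permKV.
case: (ltngtP ((s^-1)%g y) ((s^-1)%g x)) le_yx => // [_|eq_yx] _; first by lia.
by move/val_inj/perm_inj: eq_yx => eq_yx; move: xE yE; rewrite eq_yx; lia.
Qed.

(** * Rows as positions, and the two forced values *)

Definition pos (j : 'I_(2 * n)) : 'I_N :=
  inord (if j < n then 2 * j + 3 else 2 * (j - n)).

Lemma posE j : pos j = (if j < n then 2 * j + 3 else 2 * (j - n)) :> nat.
Proof. by rewrite inordK //; have := ltn_ord j; case: ifP; lia. Qed.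

Lemma pos_inj : injective pos.
Proof.
move=> i j /(congr1 val) /=; rewrite !posE => eq_ij; apply: val_inj => /=.
by move: eq_ij; do 2!case: ifP; lia.
Qed.

Lemma pos_range j : pos j <> 1 :> nat /\ pos j <> 2 * n :> nat.
Proof. by rewrite posE; have := ltn_ord j; case: ifP; lia. Qed.

Variant pos_spec (p : 'I_N) : Prop :=
  | PosFirst of p = 1 :> nat
  | PosLast of p = 2 * n :> nat
  | PosRow j of p = pos j.

Lemma posP p : pos_spec p.
Proof.
have [/eqP p1|p1] := boolP (p == 1 :> nat); first exact: PosFirst.
have [/eqP p2|p2] := boolP (p == 2 * n :> nat); first exact: PosLast.
have lt_p := ltn_ord p.
have lt_row : (if odd p then p./2 - 1 else n + p./2) < 2 * n.
  by case: ifP; lia.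
apply: (@PosRow _ (Ordinal lt_row)); apply: val_inj; rewrite /= posE /=.
by case: (boolP (odd p)); case: ifP; lia.
Qed.

(** Position 1 is in block 1, so its value is in block 0, whose only member is 0. *)
Lemma dumont2_first (s : 'S_N) (p : 'I_N) : dumont2 s -> p = 1 :> nat -> s p = 0 :> nat.
Proof. by move=> /dumont2P/(_ p); rewrite /block => + p1; rewrite p1 /=; lia. Qed.

Lemma dumont2_last (s : 'S_N) (p : 'I_N) :
  dumont2 s -> p = 2 * n :> nat -> s p = (2 * n).+1 :> nat.
Proof.
move=> /dumont2P/(_ p); rewrite /block => + p2.
have -> /= : odd p = false by lia.
by have := ltn_ord (s p); lia.
Qed.

(** The two extreme values are taken at the forced positions, so only the blocks 1 to [n] remain for
    the rows. *)
Lemma dumont2_row (s : 'S_N) j :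
  dumont2 s -> exists l : 'I_n, block (s (pos j)) = l.+1.
Proof.
move=> dum_s; have [ne1 ne2] := pos_range j.
have lt1 : 1 < N by lia.
have lt2 : 2 * n < N by lia.
have first := dumont2_first dum_s (erefl : Ordinal lt1 = 1 :> nat).
have last := dumont2_last dum_s (erefl : Ordinal lt2 = 2 * n :> nat).
have neq0 : s (pos j) <> 0 :> nat.
  move=> eq0; apply: ne1.
  have /val_inj/perm_inj-> // : s (pos j) = s (Ordinal lt1) :> nat.
  by rewrite eq0 first.
have neqN : s (pos j) <> (2 * n).+1 :> nat.
  move=> eqN; apply: ne2.
  have /val_inj/perm_inj-> // : s (pos j) = s (Ordinal lt2) :> nat.
  by rewrite eqN last.
have lt_l : (block (s (pos j))).-1 < n.
  by have := ltn_ord (s (pos j)); rewrite /block /= in neq0 neqN *; lia.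
by exists (Ordinal lt_l); rewrite /block /= in neq0 *; lia.
Qed.

(** * From permutations to Dellac configurations *)

Definition dellac_of (s : 'S_N) : {set 'I_n * 'I_(2 * n)} :=
  [set b : 'I_n * 'I_(2 * n) | block (s (pos b.2)) == b.1.+1].

Lemma card_block c :
  #|[set v : 'I_N | block v == c]| =
  (if c == 0 then 1 else if c <= n then 2 else c == n.+1).
Proof.
case: eqP => [->|/eqP c_gt0].
  apply/eqP/cards1P; exists ord0; apply/setP => v; rewrite !inE.
  by rewrite -(inj_eq val_inj) /block /=; lia.
case: ifP => [le_cn|lt_nc].
  apply/eqP/cards2P; exists (inord (2 * c).-1), (inord (2 * c)); split.
    by rewrite -(inj_eq val_inj) /= !inordK; lia.
  by apply/setP => v; rewrite !inE -!(inj_eq val_inj) /block /= !inordK; lia.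
case: eqP => [->|ne_c].
  apply/eqP/cards1P; exists ord_max; apply/setP => v; rewrite !inE.
  by rewrite -(inj_eq val_inj) /block /=; have := ltn_ord v; lia.
apply/eqP; rewrite cards_eq0; apply/eqP/setP => v; rewrite !inE /block.
by have := ltn_ord v; lia.
Qed.

Lemma dellac_of_dellac s : dumont2 s -> dellac (dellac_of s).
Proof.
move=> dum_s; apply/and3P; split.
- apply/forallP => l.
  (* The map from [b] to [s (pos b.2)] is a bijection from the boxes of column [l] to the two values
     of block [l + 1]. *)
  apply/eqP; transitivity #|[set v : 'I_N | block v == l.+1]|; last first.
    by rewrite card_block ltn_ord.
  rewrite -(@card_in_imset _ _ (fun b => s (pos b.2))).
    congr #|pred_of_set _|; apply/setP => v; rewrite [RHS]inE.
    apply/imsetP/eqP => [[b]|bv].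
      by rewrite !inE => /andP[/eqP bE /eqP <-] ->.
    case: (posP ((s^-1)%g v)) => [p1|p2|j jE].
    + have := dumont2_first dum_s p1; rewrite permKV => v0.
      by move: bv; rewrite /block /= in v0 *; rewrite v0.
    + have := dumont2_last dum_s p2; rewrite permKV => v0.
      by have := ltn_ord l; move: bv; rewrite /block /= in v0 *; rewrite v0; lia.
    + by exists (l, j); rewrite ?inE /= -jE permKV ?bv ?eqxx.
  move=> [l1 j1] [l2 j2]; rewrite !inE /= => /andP[_ /eqP->] /andP[_ /eqP->].
  by move/perm_inj/pos_inj->.
- apply/forallP => j; have [l lE] := dumont2_row j dum_s.
  apply/cards1P; exists (l, j); apply/setP => -[l' j']; rewrite !inE /= xpair_eqE.
  case: (j' =P j) => [->|_]; rewrite ?andbT ?andbF //.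
  by rewrite lE eqSS eq_sym -(inj_eq val_inj).
(* For [j < n] the position has block [j + 2], which gives [l <= j]; otherwise it has block [j - n],
   which gives [j <= n + l]. The other bound is automatic in each case. *)
- apply/forallP => -[l j]; apply/implyP; rewrite inE /label /= => /eqP lE.
  move/dumont2P: dum_s => /(_ (pos j)); rewrite lE /block posE.
  by have := ltn_ord j; have := ltn_ord l; case: ifP; case: ifP; lia.
Qed.

(** The word of blocks is forced at the two special positions and read off the boxes at the
    others. *)
Lemma dellac_of_inj : {in PD2N n &, injective dellac_of}.
Proof.
move=> s t; rewrite !inE => /andP[dum_s /normalizedP std_s].
move=> /andP[dum_t /normalizedP std_t] eq_st.
apply: (standard_unique block_mono std_s std_t) => p.
case: (posP p) => [p1|p2|j ->].
- have := dumont2_first dum_s p1; have := dumont2_first dum_t p1.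
  by rewrite /block /= => -> ->.
- have := dumont2_last dum_s p2; have := dumont2_last dum_t p2.
  by rewrite /block /= => -> ->.
- have [l lE] := dumont2_row j dum_s.
  have : (l, j) \in dellac_of s by rewrite inE lE.
  by rewrite eq_st inE lE => /eqP.
Qed.

(** * From Dellac configurations back to permutations *)

Section Surjectivity.

Variable D : {set 'I_n * 'I_(2 * n)}.
Hypothesis dellacD : dellac D.

(** The word of blocks encoded by [D]; the defaults 0 and [n + 1] serve the two positions without a
    row. *)
Definition blocks_of (p : 'I_N) : nat :=
  if [pick b in D | pos b.2 == p] is Some b then b.1.+1
  else if p == 1 :> nat then 0 else n.+1.

Lemma dellac_row j : exists l, forall l', ((l', j) \in D) = (l' == l).
Proof.
have /and3P[_ /forallP/(_ j)/cards1P[[l j0] /setP Dj] _] := dellacD.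
have := Dj (l, j0); rewrite !inE eqxx => /andP[_ /eqP /= j0E].
exists l => l'; have := Dj (l', j); rewrite !inE eqxx andbT => ->.
by rewrite xpair_eqE j0E eqxx andbT.
Qed.

Lemma blocks_of_row l j : ((l, j) \in D) = (blocks_of (pos j) == l.+1).
Proof.
have [l0 Dj] := dellac_row j; rewrite Dj /blocks_of.
case: pickP => [[l1 j1] /= /andP[+ /eqP/pos_inj j1E]|/(_ (l0, j))].
  by rewrite j1E Dj => /eqP->; rewrite eqSS eq_sym.
by rewrite /= Dj !eqxx.
Qed.

Lemma blocks_of_first (p : 'I_N) : p = 1 :> nat -> blocks_of p = 0.
Proof.
move=> p1; rewrite /blocks_of; case: pickP => [b /andP[_ /eqP bp]|_].
  by have [] := pos_range b.2; rewrite bp.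
by rewrite p1.
Qed.

Lemma blocks_of_last (p : 'I_N) : p = 2 * n :> nat -> blocks_of p = n.+1.
Proof.
move=> p1; rewrite /blocks_of; case: pickP => [b /andP[_ /eqP bp]|_].
  by have [] := pos_range b.2; rewrite bp.
by rewrite p1; case: eqP => //; lia.
Qed.

Lemma blocks_of_pos j : exists l : 'I_n, blocks_of (pos j) = l.+1.
Proof.
have [l Dj] := dellac_row j; exists l; apply/eqP.
by rewrite -blocks_of_row Dj.
Qed.

(** This is the hypothesis of [standard_exists]: each column gives its letter two positions, and the
    two positions without a row give 0 and [n + 1] once each. *)
Lemma card_blocks_of c :
  #|[set p | blocks_of p == c]| = #|[set v : 'I_N | block v == c]|.
Proof.
rewrite card_block; case: eqP => [->|/eqP c_gt0].
  have lt1 : 1 < N by lia.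
  apply/eqP/cards1P; exists (Ordinal lt1); apply/setP => p; rewrite !inE.
  rewrite -(inj_eq val_inj) /=; case: (posP p) => [p1|p2|j ->].
  - by rewrite blocks_of_first // p1.
  - by rewrite blocks_of_last // p2; lia.
  - by have [l ->] := blocks_of_pos j; have [] := pos_range j; lia.
case: ifP => [le_cn|lt_nc].
  have lt_l : c.-1 < n by lia.
  have /and3P[/forallP/(_ (Ordinal lt_l))/eqP card_col _ _] := dellacD.
  rewrite -[RHS]card_col -(@card_in_imset _ _ (fun b => pos b.2)); last first.
    move=> [l1 j1] [l2 j2]; rewrite !inE /=.
    by move=> /andP[_ /eqP->] /andP[_ /eqP->] /pos_inj->.
  congr #|pred_of_set _|; apply/setP => p; rewrite inE.
  apply/eqP/imsetP => [pc|[[l j] + ->]]; last first.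
    by rewrite inE blocks_of_row /= => /andP[/eqP-> /eqP ->] /=; lia.
  case: (posP p) => [p1|p2|j pE].
  - by move: pc; rewrite blocks_of_first //; lia.
  - by move: pc; rewrite blocks_of_last //; lia.
  - exists (Ordinal lt_l, j) => //.
    by rewrite !inE eqxx blocks_of_row -pE pc /=; lia.
case: eqP => [->|ne_c].
  have lt2 : 2 * n < N by lia.
  apply/eqP/cards1P; exists (Ordinal lt2); apply/setP => p; rewrite !inE.
  rewrite -(inj_eq val_inj) /=; case: (posP p) => [p1|p2|j ->].
  - by rewrite blocks_of_first // p1; lia.
  - by rewrite blocks_of_last // p2 !eqxx.
  - have [l ->] := blocks_of_pos j; have [] := pos_range j.
    by have := ltn_ord l; lia.
apply/eqP; rewrite cards_eq0; apply/eqP/setP => p; rewrite !inE.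
case: (posP p) => [p1|p2|j ->].
- by rewrite blocks_of_first //; lia.
- by rewrite blocks_of_last //; lia.
- by have [l ->] := blocks_of_pos j; have := ltn_ord l; lia.
Qed.

Lemma dellac_of_surj : exists2 s, s \in PD2N n & dellac_of s = D.
Proof.
have [s std_s bs] := standard_exists block_mono card_blocks_of.
exists s; last first.
  by apply/setP => -[l j]; rewrite inE bs blocks_of_row.
rewrite inE (introT (normalizedP s) std_s) andbT; apply/dumont2P => p.
rewrite bs /block; case: (posP p) => [p1|p2|j ->].
- by rewrite blocks_of_first // p1.
- by rewrite blocks_of_last // p2 mul2n odd_double; lia.
- have [l lE] := blocks_of_pos j; rewrite lE.
  have /and3P[_ _ /forallP/(_ (l, j))] := dellacD.
  rewrite blocks_of_row lE eqxx /label /= posE.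
  by have := ltn_ord j; have := ltn_ord l; case: ifP; case: ifP; lia.
Qed.

End Surjectivity.

End DumontDellac.

(** * Equality of the cardinalities *)

Theorem proposition3p3 (n : nat) (hn : 1 <= n) : #|PD2N n| = #|DC n|.
Proof.
rewrite -(card_in_imset (@dellac_of_inj n)); congr #|pred_of_set _|.
apply/setP => D; rewrite [RHS]inE; apply/imsetP/idP => [[s]|dellacD].
  by rewrite inE => /andP[dum_s _] ->; apply: dellac_of_dellac.
by have [s ? <-] := dellac_of_surj dellacD; exists s.
Qed.
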